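(* Let $G$ be a labeled hypergraph without isolated vertices, and let $(T,X)$ be a tree decomposition of $G$. Then $(T,X)$ induces an optimization term $t$ such that $\llbracket t\rrbracket_g\cong\langle\uparrow;G\rangle$, where $\uparrow:V_G\to\mathcal{N}$ is the nowhere defined function.
   Context: Names: an enumerable set $\mathcal{N}$. Atomic problems: a set $C$ of constants (the edge labels) with arity $ar:C\to\mathbb{N}$, including $nil$ with $ar(nil)=0$. Optimization terms: $p,q ::= p\parallel q \mid (x)p \mid p\pi \mid A(\tilde x)\mid nil$ with $A\in C$, $\pi$ a permutation of $\mathcal{N}$, $x\in\mathcal{N}$, $\tilde x$ a tuple of names of length $ar(A)$. An NH-graph $\langle\eta;G\rangle$ is a labeled hypergraph $G$ (vertices $V_G$, hyperedges $E_G$, attachment $a_G:E_G\to V_G^\star$, labels $lab:E_G\to C$ with $|a_G(e)|=ar(lab(e))$) without isolated vertices, with a partial injection $\eta$ from $V_G$ to $\mathcal{N}$; $\cong$ is isomorphism of labeled hypergraphs commuting with the namings. The evaluation $\llbracket-\rrbracket_g$ maps terms to NH-graphs by structural recursion: $\llbracket A(x_1,\dots,x_n)\rrbracket_g$ is a single hyperedge labeled $A$ attached to vertices $(x_1,\dots,x_n)$ named by themselves; $\llbracket nil\rrbracket_g$ is the empty NH-graph; $\llbracket p\parallel q\rrbracket_g$ is the disjoint union of $\llbracket p\rrbracket_g,\llbracket q\rrbracket_g$ with vertices bearing the same name identified (naming inherited); $\llbracket (x)p\rrbracket_g$ is $\llbracket p\rrbracket_g$ with the name $x$ removed from the naming (vertex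 becomes unnamed); $\llbracket p\pi\rrbracket_g$ is $\llbracket p\rrbracket_g$ with naming $\pi\circ\eta$. A tree decomposition of a hypergraph $G$ is a pair $(T,X)$ where $T=(N,A)$ is a tree and $X=\{X_n\}_{n\in N}$ with $X_n\subseteq V_G$ such that (a) $\bigcup_n X_n=V_G$; (b) for every $e\in E_G$ there is $n$ with all vertices of $a_G(e)$ in $X_n$; (c) for every $v\in V_G$, $\{n\in N\mid v\in X_n\}$ induces a subtree of $T$. *)

(* Defs.v *)
From HB Require Import structures.
From mathcomp Require Import all_boot.

Set Implicit Arguments.
Unset Strict Implicit.
Unset Printing Implicit Defensive.

Local Open Scope quotient_scope.

Record signature := Signature {
  label :> Type;
  arity : label -> nat;
  nil_label : label;
  arity_nil : arity nil_label = 0 }.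

(* The production [TNil] is kept apart from [TAtom (nil_label S)]: the former
   denotes the empty graph, the latter a 0-ary hyperedge. *)
Inductive term (N : countType) (S : signature) : Type :=
| TPar of term N S & term N S
| TRes of N & term N S
| TPerm of term N S & {s : N -> N | bijective s}
| TAtom (A : S) of (arity A).-tuple N
| TNil.
Arguments TAtom {N S} A xs.
Arguments TNil {N S}.

Record hypergraph (S : signature) := Hypergraph {
  vertex : finType;
  edge : finType;
  lab : edge -> S;
  att : edge -> seq vertex;
  size_att : forall e, size (att e) = arity (lab e) }.

Definition no_isolated S (G : hypergraph S) : Prop :=
  forall v : vertex G, exists e : edge G, v \in att e.

(* A partial function to [N] is a total one to [option N]. *)
Definition partial_injection (V : finType) (N : countType)
    (eta : V -> option N) : Prop :=
  forall u v x, eta u = Some x -> eta v = Some x -> u = v.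

Record nh_graph (N : countType) (S : signature) := NHGraph {
  graph :> hypergraph S;
  naming : vertex graph -> option N;
  naming_inj : partial_injection naming;
  graph_no_isolated : no_isolated graph }.

Definition nh_iso N S (H K : nh_graph N S) : Prop :=
  exists (f : vertex H -> vertex K) (g : edge H -> edge K),
    [/\ bijective f, bijective g,
        forall e, lab (g e) = lab e,
        forall e, att (g e) = map f (att e)
      & forall v, naming (f v) = naming v].

Section Unnamed.
Variables (N : countType) (S : signature) (G : hypergraph S).
Hypothesis G_ok : no_isolated G.

Lemma nowhere_inj : partial_injection (fun _ : vertex G => None : option N).
Proof. by []. Qed.

Definition nowhere_named : nh_graph N S := NHGraph nowhere_inj G_ok.

End Unnamed.

Section Empty.
Variables (N : countType) (S : signature).

Definition empty_hypergraph : hypergraph S :=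
  @Hypergraph S void void (of_void S) (of_void (seq void))
    (fun e => match e with end).

Lemma empty_inj :
  partial_injection (of_void (option N) : vertex empty_hypergraph -> _).
Proof. by case. Qed.

Lemma empty_no_isolated : no_isolated empty_hypergraph.
Proof. by case. Qed.

Definition nh_empty : nh_graph N S := NHGraph empty_inj empty_no_isolated.

End Empty.

Section Atom.
Variables (N : countType) (S : signature) (A : S) (xs : (arity A).-tuple N).

Definition atom_att (_ : unit) : seq (seq_sub xs) :=
  [seq SeqSub (mem_tnth i xs) | i <- enum 'I_(arity A)].

Lemma size_atom_att e : size (atom_att e) = arity A.
Proof. by rewrite size_map size_enum_ord. Qed.

Definition atom_hypergraph : hypergraph S :=
  @Hypergraph S (seq_sub xs) unit (fun=> A) atom_att size_atom_att.

Definition atom_naming (v : vertex atom_hypergraph) : option N := Some (ssval v).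

Lemma atom_naming_inj : partial_injection atom_naming.
Proof. by move=> u v x [<-] [/esym uv]; apply: val_inj. Qed.

Lemma atom_no_isolated : no_isolated atom_hypergraph.
Proof.
move=> v; exists tt; have /tnthP[i vi] := ssvalP v.
by apply/mapP; exists i; [rewrite mem_enum | apply: val_inj].
Qed.

Definition nh_atom : nh_graph N S := NHGraph atom_naming_inj atom_no_isolated.

End Atom.

Section Par.
Variables (N : countType) (S : signature) (H K : nh_graph N S).

Definition sum_naming (v : vertex H + vertex K) : option N :=
  match v with inl u => naming u | inr w => naming w end.

Definition same_vertex (u v : vertex H + vertex K) : bool :=
  (u == v) || (sum_naming u != None) && (sum_naming u == sum_naming v).

Lemma same_vertex_equiv : equiv_class_of same_vertex.
Proof.
split=> [u|u v|v u w]; rewrite /same_vertex; first by rewrite eqxx.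
- rewrite [v == u]eq_sym [sum_naming v == sum_naming u]eq_sym.
  by case: (sum_naming u =P sum_naming v) => [->|]; rewrite ?andbF.
- case/orP=> [/eqP-> //|/andP[uN /eqP uv]].
  case/orP=> [/eqP<-|/andP[_ /eqP<-]]; first by rewrite uN uv eqxx orbT.
  by rewrite uN uv eqxx orbT.
Qed.

Canonical same_vertex_equivRel := EquivRelPack same_vertex_equiv.

Definition par_vertex : Type := {eq_quot same_vertex}.

HB.instance Definition _ := EqQuotient.on par_vertex.
HB.instance Definition _ := Choice.on par_vertex.
HB.instance Definition _ :=
  Countable.copy par_vertex (can_type (@reprK _ par_vertex)).
HB.instance Definition _ : isFinite par_vertex :=
  CanIsFinite (@reprK _ par_vertex).

Definition par_inl (u : vertex H) : par_vertex := \pi_(par_vertex) (inl u).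
Definition par_inr (w : vertex K) : par_vertex := \pi_(par_vertex) (inr w).

Definition par_lab (e : edge H + edge K) : S :=
  match e with inl e1 => lab e1 | inr e2 => lab e2 end.

Definition par_att (e : edge H + edge K) : seq par_vertex :=
  match e with
  | inl e1 => map par_inl (att e1)
  | inr e2 => map par_inr (att e2)
  end.

Lemma size_par_att e : size (par_att e) = arity (par_lab e).
Proof. by case: e => e; rewrite size_map size_att. Qed.

Definition par_hypergraph : hypergraph S :=
  @Hypergraph S par_vertex (edge H + edge K)%type par_lab par_att size_par_att.

(* Independent of the representative, since [same_vertex] preserves names. *)
Definition par_naming (v : vertex par_hypergraph) : option N :=
  sum_naming (repr (v : par_vertex)).

Lemma par_naming_inj : partial_injection par_naming.
Proof.
move=> u v x ux vx; rewrite -[u](@reprK _ par_vertex) -[v](@reprK _ par_vertex).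
by apply/eqmodP; rewrite /= /same_vertex [sum_naming _]ux [sum_naming _]vx eqxx orbT.
Qed.

Lemma par_no_isolated : no_isolated par_hypergraph.
Proof.
move=> v; rewrite -[v](@reprK _ par_vertex).
case: (repr _) => u; have [e ue] := graph_no_isolated u.
  by exists (inl e); apply: (map_f par_inl).
by exists (inr e); apply: (map_f par_inr).
Qed.

Definition nh_par : nh_graph N S := NHGraph par_naming_inj par_no_isolated.

End Par.

Section ResPerm.
Variables (N : countType) (S : signature) (H : nh_graph N S).

Definition res_naming (x : N) (v : vertex H) : option N :=
  if naming v == Some x then None else naming v.

Lemma res_naming_inj x : partial_injection (res_naming x).
Proof.
move=> u v y; rewrite /res_naming; case: ifP => // _ uy; case: ifP => // _ vy.
exact: naming_inj uy vy.
Qed.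

Definition nh_res (x : N) : nh_graph N S :=
  NHGraph (@res_naming_inj x) (@graph_no_isolated _ _ H).

Definition perm_naming (pi : N -> N) (v : vertex H) : option N :=
  omap pi (naming v).

Lemma perm_naming_inj pi : bijective pi -> partial_injection (perm_naming pi).
Proof.
move=> /bij_inj pi_inj u v x; rewrite /perm_naming.
case uy: (naming u) => [y|] //= [<-]; case vz: (naming v) => [z|] //= [/pi_inj zy].
by apply: naming_inj uy _; rewrite vz zy.
Qed.

Definition nh_perm (pi : {s : N -> N | bijective s}) : nh_graph N S :=
  NHGraph (perm_naming_inj (proj2_sig pi)) (@graph_no_isolated _ _ H).

End ResPerm.

Fixpoint eval N S (t : term N S) : nh_graph N S :=
  match t with
  | TPar p q => nh_par (eval p) (eval q)
  | TRes x p => nh_res (eval p) x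
  | TPerm p pi => nh_perm (eval p) pi
  | TAtom A xs => nh_atom xs
  | TNil => nh_empty N S
  end.

(* The subgraph of the simple graph [adj] induced by [D] is a tree; a cycle of
   at most two vertices is just an edge traversed back and forth. *)
Definition induces_tree (T : finType) (adj : rel T) (D : {set T}) : Prop :=
  [/\ D != set0,
      {in D &, forall m n, connect [rel x y in D | adj x y] m n}
    & forall c : seq T, {subset c <= D} -> 2 < size c -> ~~ ucycleb adj c].

Record tree_decomposition S (G : hypergraph S) := TreeDecomposition {
  node : finType;
  adj : rel node;
  adj_sym : symmetric adj;
  adj_irrefl : irreflexive adj;
  adj_tree : induces_tree adj [set: node];
  bag : node -> {set vertex G};
  bag_cover : \bigcup_n bag n = [set: vertex G];
  bag_edge : forall e : edge G, exists n, {subset att e <= bag n};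
  bag_subtree : forall v : vertex G, induces_tree adj [set n | v \in bag n] }.

(* [parent] orients the tree towards the root [r]; the value [r] of
   [parent r] is a dummy. *)
Definition rooted_at S (G : hypergraph S) (D : tree_decomposition G)
    (r : node D) (parent : node D -> node D) : Prop :=
  [/\ parent r = r,
      forall n, n != r -> adj n (parent n)
    & forall n, exists k, iter k parent n = r].

Section InducedTerm.
Variables (N : countType) (S : signature) (G : hypergraph S).
Variables (D : tree_decomposition G) (r : node D) (parent : node D -> node D).
Variables (nm : vertex G -> N) (home : edge G -> node D).

(* Since the nodes whose bags contain [v] form a subtree, [v] is new at exactly
   one node, the one of that subtree that is closest to the root. *)
Definition new_vertices (n : node D) : {set vertex G} :=
  [set v in bag n | (n == r) || (v \notin bag (parent n))].

Definition edge_term (e : edge G) : term N S :=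
  TAtom (lab e) (tcast (size_att e) (map_tuple nm (in_tuple (att e)))).

(* (x_1)...(x_m)(e_1 || ... || e_k || t_1 || ... || t_l), where the x_i are the
   names of the vertices new at [n], the e_j the hyperedges placed at [n] and
   the t_h the terms of the children of [n]. *)
Definition node_term (n : node D) (sub : node D -> term N S) : term N S :=
  foldr (@TRes N S)
    (TPar (\big[@TPar N S/TNil]_(e | home e == n) edge_term e)
          (\big[@TPar N S/TNil]_(c | (c != r) && (parent c == n)) sub c))
    [seq nm v | v <- enum (new_vertices n)].

End InducedTerm.

(* The construction leaves free the root, the distinct names given to the
   vertices, and, for each hyperedge, the node where it is placed among those
   whose bag contains all its vertices. *)
Definition induces N S (G : hypergraph S) (D : tree_decomposition G)
    (t : term N S) : Prop :=
  exists (r : node D) (parent : node D -> node D)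
         (nm : vertex G -> N) (home : edge G -> node D)
         (tm : node D -> term N S),
    [/\ rooted_at r parent,
        injective nm,
        forall e, {subset att e <= bag (home e)},
        forall n, tm n = node_term r parent nm home n tm
      & t = tm r].

(* Main.v *)
(* The evaluation of every subterm of the induced term embeds into [G]: it is
   the subgraph spanned by a set of hyperedges, each vertex [v] still carrying
   its name [nm v] unless it has been restricted.  Parallel composition preserves
   this as long as the two parts have no common hyperedge and no common restricted
   vertex.  The latter holds because each vertex [v] is restricted at one node
   [top v], the root of the subtree of the nodes whose bags contain [v]: a
   hyperedge attached to [v] is placed below [top v], so distinct children of a
   node share only vertices that are not yet restricted.  At the root every
   hyperedge is present and every vertex restricted. *)
Require Import Defs.
From mathcomp Require Import all_boot.

Set Implicit Arguments.
Unset Strict Implicit.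
Unset Printing Implicit Defensive.
Local Open Scope quotient_scope.

(** * Orbits of a function, and orientation of a connected graph towards a root *)

Lemma fconnect_step (T : finType) (f : T -> T) x y :
  fconnect f x y -> x != y -> fconnect f (f x) y.
Proof.
move=> /iter_findex; case: (findex f x y) => [|k] /= <-; first by rewrite eqxx.
by rewrite -iterS iterSr fconnect_iter.
Qed.

Lemma fconnect_comparable (T : finType) (f : T -> T) x y z :
  fconnect f x y -> fconnect f x z -> fconnect f y z \/ fconnect f z y.
Proof.
move=> /iter_findex <- /iter_findex <-.
case/orP: (leq_total (findex f x y) (findex f x z)) => /subnK <-;
  rewrite iterD; [left | right]; exact: fconnect_iter.
Qed.

(** For [n] other than [r], take the first step of a shortest walk from [n] to [r]: the distance [d]
    drops each time, so iteration reaches [r]. *)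
Lemma exists_parent (T : finType) (e : rel T) (r : T) :
  (forall n, connect e n r) ->
  exists parent : T -> T,
    [/\ parent r = r, forall n, n != r -> e n (parent n)
      & forall n, exists k, iter k parent n = r].
Proof.
move=> conn.
pose walk n k := [exists p : k.-tuple T, path e n p && (last n p == r)].
have exW n : exists k, walk n k.
  have /connectP[p ep rE] := conn n.
  by exists (size p); apply/existsP; exists (in_tuple p); rewrite ep -rE eqxx.
pose d n := ex_minn (exW n).
have next n : exists m,
    if n == r then m == r else e n m && (d m < d n).
  case: eqP => [_|/eqP nr]; first by exists r.
  rewrite {2}/d; case: ex_minnP => k /existsP[[[|m p] sz] /andP[/= ep last_r]] _.
    by rewrite last_r in nr.
  case/andP: ep => enm ep; exists m; rewrite enm /= -(eqP sz) ltnS /d.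
  case: ex_minnP => j _; apply; apply/existsP; exists (in_tuple p).
  by rewrite ep last_r.
have [parent parentP] := fin_all_exists next.
exists parent; split=> [|n nr|n].
- by have:= parentP r; rewrite eqxx => /eqP.
- by have:= parentP n; rewrite (negbTE nr) => /andP[].
- have [k] := ubnP (d n); elim: k n => // k IHk n; rewrite ltnS => dn.
  have := parentP n; case: eqP => [-> _|_ /andP[_ lt_d]]; first by exists 0.
  have [j <-] := IHk (parent n) (leq_trans lt_d dn).
  by exists j.+1; rewrite iterSr.
Qed.

(** * Rooted trees given by a parent function *)

Section RootedTree.
Variables (T : finType) (r : T) (parent : T -> T).
Hypothesis parent_root : parent r = r.
Hypothesis to_root : forall n, fconnect parent n r.

Definition depth n := findex parent n r.

Lemma depth_max n : depth n < #|T|.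
Proof. exact: leq_trans (findex_max (to_root n)) (max_card _). Qed.

Lemma depth_parent n : n != r -> depth n = (depth (parent n)).+1.
Proof. by rewrite eq_sym; apply: fconnect_findex. Qed.

Lemma leq_depth m n : fconnect parent m n -> depth n <= depth m.
Proof.
move=> /iter_findex <-; elim: (findex _ _ _) => //= k; apply: leq_trans.
set x := iter _ _ _; have [->|xr] := eqVneq x r; first by rewrite parent_root.
by rewrite (depth_parent xr).
Qed.

(* [fconnect parent m n] reads: [n] is an ancestor of [m], possibly [m] itself. *)
Lemma fconnect_anti m n : fconnect parent m n -> fconnect parent n m -> m = n.
Proof.
move=> mn nm; apply/eqP; apply: contraT => neq_mn.
have mr : m != r.
  by apply: contraNneq neq_mn => mr; rewrite mr -(iter_findex mn) mr iter_fix.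
have:= leq_depth (fconnect_step mn neq_mn).
by rewrite leqNgt (leq_trans _ (leq_depth nm)) // -depth_parent.
Qed.

Definition child c n := (c != r) && (parent c == n).

Lemma child_fconnect c n : child c n -> fconnect parent c n.
Proof. by case/andP=> _ /eqP <-; apply: fconnect1. Qed.

Lemma child_nfconnect c n : child c n -> ~~ fconnect parent n c.
Proof.
case/andP=> cr /eqP <-; apply/negP=> /leq_depth.
by rewrite (depth_parent cr) ltnn.
Qed.

(** As ancestors of [m] the two children are comparable. Were they distinct, one would lie strictly
    below the other, and so would its parent [n], against the depths. *)
Lemma child_unique m c1 c2 n : child c1 n -> child c2 n ->
  fconnect parent m c1 -> fconnect parent m c2 -> c1 = c2.
Proof.
have half a b : child a n -> child b n -> fconnect parent a b -> a = b.
  move=> /andP[ar /eqP an] bn ab; apply/eqP; apply: contraT => neq_ab.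
  by have:= fconnect_step ab neq_ab; rewrite an (negbTE (child_nfconnect bn)).
move=> ch1 ch2 m1 m2; case: (fconnect_comparable m1 m2) => [|/half->//].
exact: half.
Qed.

Lemma fconnect_child m n : fconnect parent m n -> m != n ->
  exists2 c, child c n & fconnect parent m c.
Proof.
move=> /iter_findex; move: {1}(findex _ _ _) => k.
elim: k m => [|k IHk] m; first by move=> /= ->; case/eqP.
rewrite iterSr => mn neq_mn; have [pm|neq_pm] := eqVneq (parent m) n.
  exists m => //; rewrite /child pm eqxx andbT.
  by apply: contraNneq neq_mn => mr; rewrite -pm mr parent_root.
have [c cn pc] := IHk _ mn neq_pm; exists c => //.
exact: connect_trans (fconnect1 _ _) pc.
Qed.

Lemma rooted_ind (P : T -> Prop) :
  (forall n, (forall c, child c n -> P c) -> P n) -> forall n, P n.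
Proof.
move=> IH n; have [k] := ubnP (#|T| - depth n); elim: k n => // k IHk n.
rewrite ltnS => hn; apply: IH => c /andP[cr /eqP cn]; apply: IHk.
apply: leq_trans hn; rewrite (depth_parent cr) cn ltn_sub2l //.
exact: depth_max.
Qed.

(** Solves equations such as that of [node_term], which are not structurally recursive. [F] consults
    only the children of a node, so iterating it from a constant function stabilizes at [n] after
    [#|T| - depth n] rounds, deepest nodes first. *)
Lemma rooted_rec (U : Type) (u0 : U) (F : T -> (T -> U) -> U) :
  (forall n g h, (forall c, child c n -> g c = h c) -> F n g = F n h) ->
  exists f, forall n, f n = F n f.
Proof.
move=> F_ext; pose f k := iter k (fun g n => F n g) (fun=> u0).
suff stable k : forall n, #|T| - depth n <= k -> f k n = f k.+1 n.
  by exists (f #|T|) => n; apply: stable (leq_subr _ _).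
elim: k => [|k IHk] n hn.
  by move: hn; rewrite leqn0 subn_eq0 leqNgt depth_max.
apply: F_ext => c /andP[cr /eqP cn]; apply: IHk; rewrite -ltnS.
apply: leq_trans hn; rewrite (depth_parent cr) cn ltn_sub2l //.
exact: depth_max.
Qed.

(* The parent edges already connect the two ends, so any other edge would close
   a cycle. *)
Lemma adj_parent (adj : rel T) :
  symmetric adj -> irreflexive adj ->
  (forall c, 2 < size c -> ~~ ucycleb adj c) ->
  (forall n, n != r -> adj n (parent n)) ->
  forall m n, adj m n -> parent m = n \/ parent n = m.
Proof.
move=> adj_sym adj_irr acyclic adj_par m n adj_mn.
pose e := [rel x y | child x y || child y x].
have e_sym : symmetric e by move=> x y /=; rewrite orbC.
have e_adj : subrel e adj.
  by move=> x y /orP[] /andP[/adj_par + /eqP <-] //; rewrite adj_sym.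
have e_root x : connect e x r.
  apply: (connect_sub _ (to_root x)) => a _ /eqP <-.
  have [->|ar] := eqVneq a r; first by rewrite parent_root connect0.
  by apply: connect1; rewrite /= /child ar eqxx.
have: connect e m n.
  by apply: connect_trans (e_root m) _; rewrite sym_connect_sym.
(* A duplicate-free path of parent edges from [m] to [n] with no step contradicts irreflexivity,
   with one step it gives the claim, and a longer one is closed into a cycle by [adj_mn]. *)
case/connectP=> p0 ep0 nE; case/shortenP: ep0 nE => -[|x [|y p]] ep up _ nE.
- by rewrite nE /= adj_irr in adj_mn.
- move: nE ep => /= <-; rewrite andbT.
  by case/orP=> /andP[_ /eqP]; [left | right].
- have /negP[] := acyclic (m :: x :: y :: p) isT.
  rewrite /ucycleb up andbT /cycle rcons_path -nE adj_sym adj_mn andbT.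
  exact: sub_path ep.
Qed.

End RootedTree.

(** * Distinct names for the vertices *)

Lemma exists_injection (V : finType) (N : eqType) :
  (forall s : seq N, exists x, x \notin s) -> exists nm : V -> N, injective nm.
Proof.
move=> N_infinite.
have [s [sz us]] : exists s : seq N, size s = #|V| /\ uniq s.
  elim: #|V| => [|k [s [<- us]]]; first by exists [::].
  by have [x xs] := N_infinite s; exists (x :: s); rewrite /= xs us.
have [x0 _] := N_infinite [::].
exists (fun v => nth x0 s (enum_rank v)) => u v /eqP.
rewrite nth_uniq ?sz // => /eqP /ord_inj; exact: enum_rank_inj.
Qed.

(** * Subgraphs of [G] presented by NH-graphs *)

Section Presents.
Variables (N : countType) (S : signature) (G : hypergraph S).
Variable nm : vertex G -> N.
Hypothesis nm_inj : injective nm.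

(* [H] is the subgraph of [G] spanned by the hyperedges [E], in which the
   vertices in [W] are unnamed and every other vertex [v] is named [nm v]. *)
Definition presents (H : nh_graph N S) (E : {set edge G})
    (W : {set vertex G}) : Prop :=
  exists (f : vertex H -> vertex G) (g : edge H -> edge G),
    [/\ injective f, injective g /\ (forall e, (e \in codom g) = (e \in E)),
        forall e, lab (g e) = lab e,
        forall e, att (g e) = map f (att e)
      & forall v, naming v = if f v \in W then None else Some (nm (f v))].

(** Since [H] has no isolated vertices, each of its vertices is sent to a vertex of some hyperedge
    in [E]; elsewhere [W] is irrelevant. *)
Lemma presents_congr H (E E' : {set edge G}) (W W' : {set vertex G}) :
  E =i E' ->
  (forall e v, e \in E -> v \in att e -> (v \in W) = (v \in W')) ->
  presents H E W -> presents H E' W'.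
Proof.
move=> EE' WW' [f [g [f_inj [g_inj gE] g_lab g_att f_nm]]]; exists f, g.
split=> // [|v]; first by split=> // e; rewrite gE EE'.
have [e ve] := graph_no_isolated v.
rewrite f_nm (WW' (g e)) //; first by rewrite -gE codom_f.
by rewrite g_att map_f.
Qed.

Lemma presents_empty W : presents (nh_empty N S) set0 W.
Proof.
exists (of_void _), (of_void _); split=> //; try by case.
split=> [|e]; first by case.
by rewrite inE; apply/codomP=> -[[]].
Qed.

(** The vertices of an atom are the names occurring in it; each is sent to the vertex of [e] bearing
    that name. *)
Lemma presents_edge_term (e : edge G) (W : {set vertex G}) :
  (forall v, v \in att e -> v \notin W) ->
  presents (eval (edge_term nm e)) [set e] W.
Proof.
move=> eW; rewrite /edge_term /=; set xs := tcast _ _.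
have xsE : xs = map nm (att e) :> seq N by rewrite val_tcast.
have: forall u : seq_sub xs, exists v, v \in att e /\ nm v = ssval u.
  move=> u; have: ssval u \in map nm (att e) by rewrite -xsE ssvalP.
  by case/mapP=> v ve ->; exists v.
case/fin_all_exists=> f fP; exists f, (fun=> e); split=> //.
- by move=> u v uv; apply: val_inj; rewrite /= -!(proj2 (fP _)) uv.
- split=> [[] []//|e']; rewrite inE; apply/codomP/eqP=> [[]//|->].
  by exists tt.
- case; apply: (inj_map nm_inj); rewrite -xsE -map_comp /= /atom_att.
  rewrite -map_comp -[LHS]map_tnth_enum; apply: eq_map => i /=.
  by rewrite (proj2 (fP _)).
- by move=> v; rewrite (negbTE (eW _ (proj1 (fP v)))) (proj2 (fP v)).
Qed.

Lemma presents_res H E W v :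
  presents H E W -> presents (nh_res H (nm v)) E (v |: W).
Proof.
case=> f [g [f_inj gE g_lab g_att f_nm]]; exists f, g; split=> //= u.
rewrite /res_naming f_nm !inE; case: (f u \in W); first by rewrite orbT.
by rewrite orbF (inj_eq Some_inj) (inj_eq nm_inj).
Qed.

Lemma presents_foldr_res t E W (s : seq (vertex G)) :
  presents (eval t) E W ->
  presents (eval (foldr (@TRes N S) t (map nm s))) E ([set v in s] :|: W).
Proof.
move=> tEW; elim: s => [|v s /(presents_res v)] /=.
  by apply: presents_congr tEW => // e v _ _; rewrite !inE.
by apply: presents_congr => // e u _ _; rewrite !inE orbA.
Qed.

(** Parallel composition glues by name only: a vertex shared by both parts must still be named, or
    it would be duplicated. *)
Definition separated (W : {set vertex G}) (E1 E2 : {set edge G}) : Prop :=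
  forall e1 e2, e1 \in E1 -> e2 \in E2 ->
    e1 != e2 /\ (forall v, v \in att e1 -> v \in att e2 -> v \notin W).

(** The two embeddings combine into [F] on the disjoint union. Two vertices are identified exactly
    when [F] agrees on them, so [F] descends to an injection on the quotient. *)
Lemma presents_par H K E1 E2 W :
  presents H E1 W -> presents K E2 W -> separated W E1 E2 ->
  presents (nh_par H K) (E1 :|: E2) W.
Proof.
case=> f1 [g1 [f1_inj [g1_inj gE1] g1_lab g1_att f1_nm]].
case=> f2 [g2 [f2_inj [g2_inj gE2] g2_lab g2_att f2_nm]] sep.
have gE1' e : g1 e \in E1 by rewrite -gE1 codom_f.
have gE2' e : g2 e \in E2 by rewrite -gE2 codom_f.
pose F (a : vertex H + vertex K) :=
  match a with inl u => f1 u | inr w => f2 w end.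
have F_nm a : sum_naming a = if F a \in W then None else Some (nm (F a)).
  by case: a => u /=.
have F_same a b : same_vertex a b -> F a = F b.
  case/orP=> [/eqP->//|]; rewrite !F_nm.
  by case: ifP => // _ /andP[_]; case: ifP => // _ /eqP[/nm_inj].
have F_shared u w : f1 u = f2 w -> f1 u \notin W.
  have [e1 u1] := graph_no_isolated u; have [e2 w2] := graph_no_isolated w.
  move=> uw; have [_] := sep _ _ (gE1' e1) (gE2' e2); apply.
    by rewrite g1_att map_f.
  by rewrite uw g2_att map_f.
have same_F a b : F a = F b -> same_vertex a b.
  move=> ab; rewrite /same_vertex !F_nm -ab; case: ifP => [FaW|_].
    (* Unnamed vertices are not shared by the two sides, so [a] and [b] lie on the same side, where
       the embedding is injective. *)
    apply/orP; left; apply/eqP; case: a b ab FaW => [u|u] [w|w] /= ab FaW.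
    - by rewrite (f1_inj _ _ ab).
    - by have:= F_shared _ _ ab; rewrite FaW.
    - by have:= F_shared _ _ (esym ab); rewrite -ab FaW.
    - by rewrite (f2_inj _ _ ab).
  by rewrite eqxx orbT.
have F_pi a : F (repr (\pi_(par_vertex H K) a)) = F a.
  by apply: F_same; apply/eqmodP; rewrite reprK.
exists (fun x : par_vertex H K => F (repr x)).
exists (fun e => match e with inl e1 => g1 e1 | inr e2 => g2 e2 end).
split.
- move=> x y xy; rewrite -[x]reprK -[y]reprK; apply/eqmodP; exact: same_F.
- split=> [[a|a] [b|b]|e].
  + by move/g1_inj->.
  + by move/eqP; have [/negbTE->] := sep _ _ (gE1' a) (gE2' b).
  + by move/esym/eqP; have [/negbTE->] := sep _ _ (gE1' b) (gE2' a).
  + by move/g2_inj->.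
  rewrite inE -gE1 -gE2; apply/codomP/orP.
    by case=> -[a|a] ->; [left | right]; apply: codom_f.
  by case=> /codomP[a ->]; [exists (inl a) | exists (inr a)].
- by case.
- case=> e /=; rewrite ?g1_att ?g2_att -map_comp;
    by apply: eq_map => u /=; rewrite F_pi.
- by move=> x; apply: F_nm.
Qed.

Lemma presents_big_par (I : finType) (P : pred I) (t : I -> term N S)
    (E : I -> {set edge G}) (W : {set vertex G}) :
  (forall i, P i -> presents (eval (t i)) (E i) W) ->
  (forall i j, P i -> P j -> i != j -> separated W (E i) (E j)) ->
  presents (eval (\big[@TPar N S/TNil]_(i | P i) t i))
    [set e | [exists i, P i && (e \in E i)]] W.
Proof.
move=> tP sep; set s := index_enum I.
suff: presents (eval (\big[@TPar N S/TNil]_(i <- s | P i) t i))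
    [set e | has (fun i => P i && (e \in E i)) s] W.
  apply: presents_congr => // e; rewrite !inE; apply/hasP/existsP.
    by case=> i _ ei; exists i.
  by case=> i ei; exists i; rewrite ?mem_index_enum.
(* Uniqueness of the list makes its head differ from all later indices, as [sep] requires. *)
elim: s (index_enum_uniq I : uniq s) => [_|i s IHs] /=.
  rewrite big_nil.
  by apply: presents_congr (presents_empty W) => // e; rewrite !inE.
case/andP=> i_s /IHs{}IHs; rewrite big_cons.
have [Pi|_] := boolP (P i); last by apply: presents_congr IHs => // e; rewrite !inE.
apply: (presents_congr _ _ (presents_par (tP i Pi) IHs _)) => //.
  by move=> e; rewrite !inE.
move=> e1 e2 e1i; rewrite inE => /hasP[j js /andP[Pj e2j]]; apply: (sep i j) => //.
by apply: contraNneq i_s => ->.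
Qed.

End Presents.

(** * Terms induced by a tree decomposition *)

Section InducedTerms.
Variables (N : countType) (S : signature) (G : hypergraph S).
Variables (D : tree_decomposition G) (r : node D) (parent : node D -> node D).
Hypothesis root : rooted_at r parent.

Lemma rooted_fconnect n : fconnect parent n r.
Proof. by case: root => _ _ /(_ n)[k <-]; apply: fconnect_iter. Qed.

(** A walk from [d] to [m] through bags containing [v] stays below [d]: it could only leave through
    the parent of [d], whose bag lacks [v] unless [d] is the root. *)
Lemma new_vertex_fconnect v d m :
  v \in new_vertices r parent d -> v \in bag m -> fconnect parent m d.
Proof.
case: root => parent_root adj_par _; rewrite inE => /andP[vd d_new] vm.
have [_ /(_ d m) conn _] := bag_subtree D v; rewrite !inE in conn.
have /connectP[p] := conn vd vm; have := connect0 (frel parent) d.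
(* The start of the walk is generalized to any node [x] below [d]. *)
move: {1 3 4}d => x; elim: p x {conn vm} => [|y p IHp] x /= xd; first by move=> _ ->.
case/andP=> /andP[/andP[_ vy] adj_xy] yp mE; apply: IHp yp mE.
rewrite inE in vy.
have [_ _ acyclic] := adj_tree D.
have acyclic' c : 2 < size c -> ~~ ucycleb (@adj _ _ D) c.
  by apply: acyclic => z; rewrite inE.
have [xy|yx] := adj_parent parent_root rooted_fconnect (@adj_sym _ _ D)
  (@adj_irrefl _ _ D) acyclic' adj_par adj_xy; last first.
  by apply: connect_trans xd; rewrite -yx fconnect1.
have [xE|x_neq_d] := eqVneq x d; last by rewrite -xy fconnect_step.
move: d_new; rewrite -xE xy vy orbF => /eqP xr.
by rewrite -xy xr parent_root connect0.
Qed.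

(** Climb from a node whose bag contains [v] until the root is reached or the next bag loses [v].
    Two nodes where [v] is new lie below each other, hence coincide. *)
Lemma exists_top : exists top : vertex G -> node D,
  (forall v m, (v \in new_vertices r parent m) = (top v == m)) /\
  (forall v m, v \in bag m -> fconnect parent m (top v)).
Proof.
have new v : exists d, v \in new_vertices r parent d.
  have: v \in \bigcup_n @bag _ _ D n by rewrite bag_cover inE.
  case/bigcupP=> n _; have [k] := ubnP (depth r parent n).
  elim: k n => // k IHk n; rewrite ltnS => dn vn.
  have [nr|n_neq_r] := eqVneq n r; first by exists n; rewrite inE vn nr eqxx.
  have [vp|vNp] := boolP (v \in bag (parent n)).
    by apply: IHk vp; rewrite -(depth_parent rooted_fconnect).
  by exists n; rewrite inE vn vNp orbT.
have [top topP] := fin_all_exists new.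
have up v m : v \in bag m -> fconnect parent m (top v).
  exact: new_vertex_fconnect.
exists top; split=> // v m; apply/idP/eqP=> [vm|<-//].
have [parent_root _ _] := root.
apply: (fconnect_anti parent_root rooted_fconnect).
  by apply: new_vertex_fconnect vm _; case/setIdP: (topP v).
by apply: up; case/setIdP: vm.
Qed.

Variables (nm : vertex G -> N) (home : edge G -> node D).
Hypothesis nm_inj : injective nm.
Hypothesis home_bag : forall e, {subset att e <= bag (home e)}.

Lemma exists_node_terms :
  exists tm : node D -> term N S, forall n, tm n = node_term r parent nm home n tm.
Proof.
apply: (rooted_rec rooted_fconnect TNil) => n g h gh.
by rewrite /node_term; congr (foldr _ (TPar _ _) _); apply: eq_bigr.
Qed.

Variable tm : node D -> term N S.
Hypothesis tmE : forall n, tm n = node_term r parent nm home n tm.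

(** Induction from the leaves. The hyperedges placed at [n] and the terms of the children are
    composed over a common set [W]; the restrictions at [n] then add the vertices whose [top] is
    [n]. *)
Lemma presents_node_term (top : vertex G -> node D) :
  (forall v m, (v \in new_vertices r parent m) = (top v == m)) ->
  (forall v m, v \in bag m -> fconnect parent m (top v)) ->
  forall n, presents nm (eval (tm n)) [set e | fconnect parent (home e) n]
                                  [set v | fconnect parent (top v) n].
Proof.
have [parent_root _ _] := root.
move=> top_new top_up; apply: (rooted_ind rooted_fconnect) => n IHn.
have e_top e v : v \in att e -> fconnect parent (home e) (top v).
  by move=> /home_bag/top_up.
(* The vertices restricted strictly below [n]. *)
pose W := [set v | fconnect parent (top v) n && (top v != n)].
have W_child v : v \in W -> exists2 c, child r parent c n & fconnect parent (top v) c.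
  by rewrite inE => /andP[]; apply: fconnect_child.
have home_W e v : home e = n -> v \in att e -> v \notin W.
  move=> en /e_top; rewrite en inE => nv; apply/andP=> -[vn /eqP[]].
  exact: fconnect_anti parent_root rooted_fconnect _ _ vn nv.
(* [top v] lies below some child of [n], and [home e] lies below [top v]; that child must therefore
   be [c]. *)
have shared e v c : child r parent c n -> fconnect parent (home e) c ->
    v \in att e -> v \in W -> fconnect parent (top v) c.
  move=> cn ec /e_top ev /W_child[c' c'n vc'].
  rewrite (child_unique parent_root rooted_fconnect cn c'n ec) //.
  exact: connect_trans ev vc'.
have edges : presents nm
    (eval (\big[@TPar N S/TNil]_(e | home e == n) edge_term nm e))
    [set e | home e == n] W.
  have sep e1 e2 : home e1 == n -> home e2 == n -> e1 != e2 ->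
      separated W [set e1] [set e2].
    move=> e1n _ e12 _ _ /set1P-> /set1P->; split=> // v ve1 _.
    exact: home_W (eqP e1n) ve1.
  apply: presents_congr (presents_big_par nm_inj _ sep) => // [e|e /eqP en].
    rewrite !inE; apply/existsP/idP=> [[e' /andP[en /set1P->]] //|en].
    by exists e; rewrite en set11.
  by apply: presents_edge_term => // v; apply: home_W en.
have children : presents nm
    (eval (\big[@TPar N S/TNil]_(c | (c != r) && (parent c == n)) tm c))
    [set e | [exists c, child r parent c n &&
                        (e \in [set e | fconnect parent (home e) c])]] W.
  apply: presents_big_par => // [c cn|c1 c2 c1n c2n neq_c e1 e2].
    (* [W] also contains vertices restricted below other children, but none of them is attached to a
       hyperedge placed below [c]. *)
    apply: presents_congr (IHn c cn) => // e v; rewrite inE => ec ve.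
    apply/idP/idP=> [|vW]; last by rewrite inE (shared e).
    rewrite !inE => vc; rewrite (connect_trans vc (child_fconnect cn)).
    apply: contraNneq (child_nfconnect parent_root rooted_fconnect cn) => <-.
    exact: vc.
  rewrite !inE => e1c e2c; split=> [|v ve1 ve2].
    apply: contraNneq neq_c => e12; apply/eqP; rewrite -e12 in e2c.
    by apply: (child_unique parent_root rooted_fconnect c1n c2n) e2c.
  apply: contraNN neq_c => vW; apply/eqP.
  apply: (child_unique parent_root rooted_fconnect c1n c2n).
    exact: shared c1n e1c ve1 vW.
  exact: shared c2n e2c ve2 vW.
rewrite tmE /node_term.
have sep : separated W [set e | home e == n]
    [set e | [exists c, child r parent c n &&
                        (e \in [set e | fconnect parent (home e) c])]].
  move=> e1 e2; rewrite !inE => /eqP e1n /existsP[c /andP[cn]].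
  rewrite inE => e2c; split=> [|v ve1 _]; last exact: home_W ve1.
  apply: contraNneq (child_nfconnect parent_root rooted_fconnect cn) => e12.
  by rewrite -e1n e12.
have:= presents_foldr_res nm_inj (enum (new_vertices r parent n))
  (presents_par nm_inj edges children sep : presents nm (eval (TPar _ _)) _ _).
apply: presents_congr => [e|e v _ _]; rewrite !inE.
  apply/orP/idP=> [[/eqP en|/existsP[c /andP[cn]]]|en].
    by rewrite en connect0.
    by rewrite inE => /connect_trans; apply; apply: child_fconnect cn.
  have [_|neq_en] := eqVneq (home e) n; [by left | right].
  have [c cn ec] := fconnect_child parent_root en neq_en.
  by apply/existsP; exists c; rewrite cn inE.
rewrite mem_enum top_new; have [->|_] /= := eqVneq (top v) n.
  by rewrite connect0.
by rewrite andbT.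
Qed.

(** Every node lies below the root, so all hyperedges are reached and all vertices unnamed.
    Surjectivity on vertices follows from that on hyperedges because [G] has no isolated
    vertices. *)
Lemma eval_induced (G_ok : no_isolated G) :
  nh_iso (eval (tm r)) (nowhere_named N G_ok).
Proof.
have [top [top_new top_up]] := exists_top.
have [f [g [f_inj [g_inj gE] g_lab g_att f_nm]]] :=
  presents_node_term top_new top_up r.
have g_onto e : e \in codom g by rewrite gE inE rooted_fconnect.
have f_onto v : v \in codom f.
  have [e ve] := G_ok v; have /codomP[e' eE] := g_onto e.
  by move: ve; rewrite eE g_att => /mapP[u _ ->]; apply: codom_f.
have bij (A B : finType) (h : A -> B) :
    injective h -> (forall b, b \in codom h) -> bijective h.
  move=> h_inj h_onto; exists (fun b => iinv (h_onto b)) => x.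
    exact: iinv_f.
  exact: f_iinv.
exists f, g; split=> //; try exact: bij.
by move=> v /=; rewrite f_nm inE rooted_fconnect.
Qed.

End InducedTerms.

Theorem theorem1 (N : countType)
    (N_infinite : forall s : seq N, exists x : N, x \notin s)
    (S : signature) (G : hypergraph S) (G_ok : no_isolated G)
    (D : tree_decomposition G) :
  (exists t : term N S, induces D t) /\
  (forall t : term N S, induces D t -> nh_iso (eval t) (nowhere_named N G_ok)).
Proof.
split; last first.
  move=> _ [r [parent [nm [home [tm [root nm_inj home_bag tmE ->]]]]]].
  exact: (eval_induced root nm_inj home_bag tmE).
(* A tree is nonempty, and any of its nodes can serve as the root. *)
have [/set0Pn[r _] conn _] := adj_tree D.
have to_root n : connect (@adj _ _ D) n r.
  by apply: connect_sub (conn n r _ _); rewrite ?inE // => x y /andP[_ /connect1].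
have [parent root] := exists_parent to_root.
have [nm nm_inj] := exists_injection (vertex G) N_infinite.
have /fin_all_exists[home home_bag] := @bag_edge _ _ D.
have [tm tmE] := exists_node_terms (N := N) root nm home.
by exists (tm r), r, parent, nm, home, tm.
Qed.
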